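(* Let $(X_t)_{t\in\mathbb{Z}}$ be a centered strictly stationary process with finite second moments satisfying $X_t-\phi X_{t-1}=Z_t$ for every $t\in\mathbb{Z}$, where $\phi=e^{-H}$ for some $H>0$ and $(Z_t)_{t\in\mathbb{Z}}$ is a strictly stationary process. Let $\gamma(n)=\operatorname{cov}(X_t,X_{t+n})$ and $r(n)=\operatorname{cov}(Z_t,Z_{t+n})$, and let $N\in\mathbb{N}$ be fixed. (1) If $\gamma(N)\neq 0$, then either $$\phi=\frac{\gamma(N+1)+\gamma(N-1)+\sqrt{(\gamma(N+1)+\gamma(N-1))^2-4\gamma(N)(\gamma(N)-r(N))}}{2\gamma(N)}$$ or $$\phi=\frac{\gamma(N+1)+\gamma(N-1)-\sqrt{(\gamma(N+1)+\gamma(N-1))^2-4\gamma(N)(\gamma(N)-r(N))}}{2\gamma(N)}.$$ (2) If $\gamma(N)=0$ and $r(N)\neq 0$, then $$\phi=-\frac{r(N)}{\gamma(N+1)+\gamma(N-1)}.$$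
   Context: All processes are real-valued. A process $X=(X_t)_{t\in\mathbb{Z}}$ is strictly stationary if $(X_{t+n_1},\ldots,X_{t+n_k})$ and $(X_{n_1},\ldots,X_{n_k})$ have the same law for all $k\in\mathbb{N}$ and $t,n_1,\ldots,n_k\in\mathbb{Z}$. Centered means $\mathbb{E}(X_t)=0$ for every $t$ (hence also $\mathbb{E}(Z_t)=0$). The index $N=0$ is allowed. *)

(* Defs.v *)
From HB Require Import structures.
From mathcomp Require Import all_boot all_order all_algebra.
From mathcomp Require Import all_classical all_reals all_analysis.
From mathcomp Require Import measurable_realfun.
Set Implicit Arguments.
Unset Strict Implicit.
Unset Printing Implicit Defensive.
Import Order.TTheory GRing.Theory Num.Theory.
Local Open Scope classical_set_scope.
Local Open Scope ring_scope.

Section process.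
Context d (T : measurableType d) (R : realType) (P : probability T R).

Definition process_vector (X : int -> {RV P >-> R}) k (m : k.-tuple int)
  : T -> k.-tuple R := fun w => [tuple X (tnth m i) w | i < k].

Lemma measurable_process_vector X k (m : k.-tuple int) :
  measurable_fun [set: T] (process_vector X m).
Proof.
apply/measurable_fun_tnthP => i.
rewrite (_ : _ \o _ = X (tnth m i))//.
by apply/funext => w /=; rewrite tnth_mktuple.
Qed.

HB.instance Definition _ X k (m : k.-tuple int) :=
  @isMeasurableFun.Build _ _ _ _ (process_vector X m)
    (measurable_process_vector X m).

(* Laws are compared on measurable sets only: [distribution] is defined on all
   sets but is a measure only on the product Borel sigma-algebra of R^k. *)
Definition strictly_stationary (X : int -> {RV P >-> R}) :=
  forall k (t : int) (m : k.-tuple int) (B : set (k.-tuple R)), measurable B ->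
    distribution P (process_vector X [tuple t + tnth m i | i < k]) B =
    distribution P (process_vector X m) B.

(* The base point 0 is immaterial for a strictly stationary process with finite
   second moments: see [autocovE]. *)
Definition autocov (X : int -> {RV P >-> R}) (n : int) : R :=
  fine (covariance P (X 0) (X n)).

Lemma stationary_expectation X k (t : int) (m : k.-tuple int)
    (f : k.-tuple R -> R) : strictly_stationary X ->
    measurable_fun [set: k.-tuple R] f ->
    f \o process_vector X [tuple t + tnth m i | i < k] \in Lfun P 1 ->
    f \o process_vector X m \in Lfun P 1 ->
  ('E_P[f \o process_vector X [tuple (t + tnth m i)%R | i < k]] =
   'E_P[f \o process_vector X m])%E.
Proof.
move=> sX mf /Lfun1_integrable i1 /Lfun1_integrable i2.
have mEf : measurable_fun [set: k.-tuple R] (EFin \o f).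
  exact/measurable_EFinP.
have dE (m' : k.-tuple int) :
    P.-integrable [set: T] (EFin \o (f \o process_vector X m')) ->
    (\int[P]_w ((f \o process_vector X m') w)%:E =
     \int[distribution P (process_vector X m')]_y (f y)%:E)%E.
  by move=> im'; rewrite (integral_distribution mEf).
rewrite unlock !dE//.
apply: eq_measure_integral => B mB _; exact: sX.
Qed.

Lemma autocovE X (t n : int) : strictly_stationary X ->
    (forall s, (X s : T -> R) \in Lfun P 2%:E) ->
  covariance P (X t) (X (t + n)) = (autocov X n)%:E.
Proof.
move=> sX X2.
have Pfin : P setT \is a fin_num := fin_num_measure P _ measurableT.
have X1 s : (X s : T -> R) \in Lfun P 1 := Lfun_subset12 Pfin (X2 s).
have XX1 s s' : ((X s : T -> R) * X s')%R \in Lfun P 1.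
  exact: Lfun2_mul_Lfun1.
rewrite /autocov fineK ?covariance_fin_num// !covarianceE//.
pose m : 2.-tuple int := [tuple 0; n].
pose c (i : 'I_2) := fun y : 2.-tuple R => tnth y i.
have mc i : measurable_fun setT (c i) by exact: measurable_tnth.
have cE i (m' : 2.-tuple int) : c i \o process_vector X m' = X (tnth m' i).
  by apply/funext => w /=; rewrite /c tnth_mktuple.
have pE (m' : 2.-tuple int) : (fun y => c ord0 y * c ord_max y)%R \o
    process_vector X m' = (X (tnth m' ord0) : T -> R) * X (tnth m' ord_max).
  by apply/funext => w /=; rewrite /c !tnth_mktuple.
have e0 : ('E_P[X t] = 'E_P[X 0%R])%E.
  have := @stationary_expectation X 2 t m (c ord0) sX (mc _).
  by rewrite !cE tnth_mktuple /m /= addr0; apply.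
have en : ('E_P[X (t + n)%R] = 'E_P[X n])%E.
  have := @stationary_expectation X 2 t m (c ord_max) sX (mc _).
  by rewrite !cE tnth_mktuple /m; apply.
have ep : ('E_P[((X t : T -> R) * X (t + n))%R] =
             'E_P[((X 0 : T -> R) * X n)%R])%E.
  have := @stationary_expectation X 2 t m _ sX
    (measurable_funM (mc ord0) (mc ord_max)).
  by rewrite !pE !tnth_mktuple /m /= addr0; apply.
by rewrite e0 en ep.
Qed.

End process.

(* Main.v *)
(* Taking the covariance of Z_0 = X_0 - phi X_{-1} with Z_N = X_N - phi X_{N-1}
   turns the AR(1) equation into the quadratic equation
   gamma(N) phi^2 - (gamma(N+1) + gamma(N-1)) phi + gamma(N) - r(N) = 0.
   It is solved by the quadratic formula, or as a linear equation when
   gamma(N) = 0. *)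
Require Import Defs.
From mathcomp Require Import all_boot all_order all_algebra.
From mathcomp Require Import all_classical all_reals all_analysis.
From mathcomp Require Import measurable_realfun ring.
Set Implicit Arguments.
Unset Strict Implicit.
Import Order.TTheory GRing.Theory Num.Theory.
Local Open Scope classical_set_scope.
Local Open Scope ring_scope.

Lemma ae_eq_expectation d (T : measurableType d) (R : realType)
    (P : probability T R) (U V : T -> R) :
  measurable_fun setT U -> measurable_fun setT V ->
  {ae P, forall w, U w = V w} -> ('E_P[U] = 'E_P[V])%E.
Proof.
move=> mU mV UV; rewrite unlock; apply: ae_eq_integral => //.
- exact/measurable_EFinP.
- exact/measurable_EFinP.
- by apply: filterS UV => w -> _.
Qed.

(** The centring constants agree because the expectations do, and then the centred products agree
    almost everywhere. This lets [Z] be replaced by an expression in [X] although the AR(1) equation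
    holds only almost surely. *)
Lemma ae_eq_covariance d (T : measurableType d) (R : realType)
    (P : probability T R) (U U' V V' : T -> R) :
  measurable_fun setT U -> measurable_fun setT U' ->
  measurable_fun setT V -> measurable_fun setT V' ->
  {ae P, forall w, U w = U' w} -> {ae P, forall w, V w = V' w} ->
  covariance P U V = covariance P U' V'.
Proof.
move=> mU mU' mV mV' UU' VV'; rewrite unlock.
rewrite (ae_eq_expectation mU mU' UU') (ae_eq_expectation mV mV' VV').
apply: ae_eq_expectation.
- by apply: measurable_funM; apply: measurable_funB.
- by apply: measurable_funM; apply: measurable_funB.
- by apply: filterS2 UU' VV' => w Uw Vw; rewrite /GRing.mul /= Uw Vw.
Qed.

Lemma stationary_covariance d (T : measurableType d) (R : realType)
    (P : probability T R) (X : int -> {RV P >-> R}) (s t : int) :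
  strictly_stationary X -> (forall u, (X u : T -> R) \in Lfun P 2%:E) ->
  covariance P (X s) (X t) = (autocov X (t - s))%:E.
Proof. by move=> sX X2; rewrite -(autocovE s) // subrKC. Qed.

Lemma autocov_AR1 d (T : measurableType d) (R : realType)
    (P : probability T R) (X Z : int -> {RV P >-> R}) (phi : R) (n : int) :
  strictly_stationary X -> (forall t, (X t : T -> R) \in Lfun P 2%:E) ->
  (forall t, {ae P, forall w, X t w - phi * X (t - 1) w = Z t w}) ->
  autocov Z n =
    autocov X n * phi ^+ 2 - (autocov X (n + 1) + autocov X (n - 1)) * phi +
    autocov X n.
Proof.
move=> sX X2 XZ.
have Pfin : P setT \is a fin_num := fin_num_measure P _ measurableT.
have X1 t : (X t : T -> R) \in Lfun P 1 := Lfun_subset12 Pfin (X2 t).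
have XX1 s t : ((X s : T -> R) * X t)%R \in Lfun P 1.
  exact: Lfun2_mul_Lfun1.
pose W t : T -> R := (X t : T -> R) \- phi \o* (X (t - 1) : T -> R).
have pX2 t : (phi \o* (X t : T -> R)) \in Lfun P 2%:E.
  by apply: Lfun_scale => //; rewrite ler1n.
have pX1 t : (phi \o* (X t : T -> R)) \in Lfun P 1.
  exact: Lfun_scale.
have XpX1 s t : ((X s : T -> R) * (phi \o* (X t : T -> R)))%R \in Lfun P 1.
  exact: Lfun2_mul_Lfun1.
have W2 t : W t \in Lfun P 2%:E by rewrite rpredB ?lee1n.
have mW t : measurable_fun setT (W t).
  by apply: measurable_funB => //; apply: measurable_funM.
have WZ t : {ae P, forall w, Z t w = W t w}.
  by apply: filterS (XZ t) => w <-; rewrite /W /= mulrC.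
rewrite {1}/autocov (ae_eq_covariance _ (mW 0) _ (mW n) (WZ 0) (WZ n)) //.
rewrite /W covarianceBl //; last exact: (W2 n).
rewrite !covarianceBr // !covarianceZl // !covarianceZr //.
(* All four covariances become finite reals, so [fine] disappears. Their lags are n, n - 1, n + 1
   and n, the last for X_{-1} against X_{n-1}. *)
rewrite !stationary_covariance //=.
rewrite (_ : n - 1 - (0 - 1) = n); last by ring.
rewrite (_ : n - (0 - 1) = n + 1); last by ring.
rewrite !subr0; ring.
Qed.

(** The conjunct [0 <= D] ensures that [Num.sqrt D] is a genuine root, since [Num.sqrt] is 0 on
    negative reals. The subtraction [N%:Z - 1] is in the integers, so N = 0 gives lag -1. *)
Theorem corollary2 (R : realType) (d : measure_display) (T : measurableType d)
    (P : probability T R) (X Z : int -> {RV P >-> R}) (H : R) (N : nat) :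
  strictly_stationary X ->
  strictly_stationary Z ->
  (forall t : int, (X t : T -> R) \in Lfun P 2%:E) ->
  (forall t : int, ('E_P[X t] = 0)%E) ->
  0 < H ->
  let phi : R := expR (- H) in
  (forall t : int, {ae P, forall w, X t w - phi * X (t - 1) w = Z t w}) ->
  let gamma : int -> R := autocov X in
  let r : int -> R := autocov Z in
  let s : R := gamma (N%:Z + 1) + gamma (N%:Z - 1) in
  let D : R := s ^+ 2 - 4 * gamma N%:Z * (gamma N%:Z - r N%:Z) in
  (gamma N%:Z != 0 ->
     0 <= D /\
     (phi = (s + Num.sqrt D) / (2 * gamma N%:Z) \/
      phi = (s - Num.sqrt D) / (2 * gamma N%:Z))) /\
  (gamma N%:Z = 0 -> r N%:Z != 0 -> phi = - (r N%:Z / s)).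
Proof.
move=> sX _ X2 _ _ phi XZ gamma r s D.
have rE : r N%:Z = gamma N%:Z * phi ^+ 2 - s * phi + gamma N%:Z.
  exact: autocov_AR1.
(* Only the quadratic relation [rE] matters from here, with [phi] and [s] as opaque reals. *)
clearbody phi s; split=> [g0 | g0 r0].
(* The discriminant is the square of the derivative of the quadratic at its root [phi]. *)
- have DE : D = (2 * gamma N%:Z * phi - s) ^+ 2 by rewrite /D rE; ring.
  split; first by rewrite DE sqr_ge0.
  rewrite DE sqrtr_sqr.
  (* The sign inside the absolute value selects the root: plus if nonnegative, minus otherwise. *)
  by case: (ger0P (2 * gamma N%:Z * phi - s)) => _; [left | right]; field.
- move: r0; rewrite rE g0 mul0r add0r addr0 => r0.
  (* The relation is now r(N) = - s phi, so r(N) != 0 makes the division by [s] legitimate. *)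
  have s0 : s != 0 by apply: contra_neq r0 => ->; rewrite mul0r oppr0.
  by field.
Qed.
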